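(* Consider a multiclass queueing network with $K$ queues partitioned into $J$ disjoint groups $\mathcal{G}_1,\dots,\mathcal{G}_J$ ($K$, $J$ and the group sizes arbitrary), routing matrix $\mathbf{R}$ such that the network is open, exogenous arrival rate vector $\boldsymbol{\lambda}$ and service rate vector $\boldsymbol{\mu}$. Suppose that the network is acyclic and that the utilization condition holds: there is $\epsilon>0$ such that $$\sum_{i\in\mathcal{G}_j}\frac{\nu_i}{\mu_i}\le 1-\epsilon\qquad\text{for all } j=1,\dots,J,$$ where $\boldsymbol{\nu}=(\mathbf{I}-\mathbf{R}^T)^{-1}\boldsymbol{\lambda}$. Then the network is stable under longest-dominating-queue (LDQ) scheduling; that is, its LDQ fluid model is stable: there exists $\delta>0$ such that every LDQ fluid solution $(\mathbf{X},\mathbf{T})$ with $\|\mathbf{X}(0)\|\le 1$ satisfies $\mathbf{X}(t)=\mathbf{0}$ for all $t>\delta$.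
   Context: Network data. $\mathbf{R}=(r_{ik})$ is a $K\times K$ matrix with $r_{ik}\ge 0$ and $\sum_k r_{ik}\le 1$; $r_{ik}$ is the probability that a job leaving queue $i$ goes to queue $k$ (with probability $1-\sum_k r_{ik}$ it leaves the network). The network is open: all jobs eventually leave, i.e. the series $\mathbf{I}+\mathbf{R}^T+(\mathbf{R}^T)^2+\cdots$ converges, and equals $(\mathbf{I}-\mathbf{R}^T)^{-1}$. The exogenous arrival rates are $\lambda_i\ge 0$ and the service rates are $\mu_i>0$, $i=1,\dots,K$. In each group only one queue can be served at a time. The network is acyclic if there is no finite sequence of queues $(i_1,i_2,\dots,i_\ell,i_1)$ with $r_{i_1i_2}r_{i_2i_3}\cdots r_{i_\ell i_1}>0$. LDQ scheduling. A queue is dominating if it has the globally maximum length in the network or does not feed any queue of globally maximum length. In each group the longest dominating queue is served; if the group has no dominating queue, no queue of that group is served. LDQ fluid model. A fluid solution is a pair of functions $\mathbf{X},\mathbf{T}:[0,\infty)\to[0,\infty)^K$, where $X_k(t)$ is the fluid level of queue $k$ and $T_k(t)$ is the cumulative time that queue $k$ has been served up to time $t$. Each $T_k$ is nondecreasing with $T_k(0)=0$, and $\sum_{i\in\mathcal{G}_j}(T_i(t)-T_i(s))\le t-s$ for all $0\le s\le t$ and all $j$. For all $t\ge 0$, $$X_k(t)=X_k(0)+\lambda_k t-\mu_kT_k(t)+\sum_{i=1}^K r_{ik}\mu_iT_i(t),\qquad k=1,\dots,K.$$ At time $t$ define - $S=\{i: X_i=\max_k X_k\}$ (globally maximum queues);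 - $\mathcal{D}_j=\{i\in\mathcal{G}_j: \text{for all } s\in S,\ X_i<X_s \text{ implies } r_{is}=0\}$ (dominating queues of group $j$); - $\tilde S_j=\{i\in\mathcal{D}_j: X_i=\max_{k\in\mathcal{D}_j}X_k\}$ (longest dominating queues of group $j$; empty if $\mathcal{D}_j=\emptyset$); - $\mathcal{J}=\{j: \exists\, i\in\mathcal{G}_j\cap S \text{ such that } r_{is}=0 \text{ for all } s\in S\}$. An LDQ fluid solution satisfies in addition, at every $t>0$ at which all the $T_i$ are differentiable and $\mathbf{X}(t)\ne\mathbf{0}$: $\sum_{i\in\tilde S_j}\dot T_i(t)=1$ if $j\in\mathcal{J}$; $\sum_{i\in\tilde S_j}\dot T_i(t)\le 1$ if $j\notin\mathcal{J}$; and $\sum_{i\in\mathcal{G}_j\setminus\tilde S_j}\dot T_i(t)=0$ for every $j$. *)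

(* Defs.v *)
From HB Require Import structures.
From mathcomp Require Import all_boot all_order all_algebra.
From mathcomp Require Import all_classical all_reals all_analysis.
Set Implicit Arguments.
Unset Strict Implicit.
Unset Printing Implicit Defensive.
Import Order.TTheory GRing.Theory Num.Theory.
Import numFieldNormedType.Exports.
Local Open Scope classical_set_scope.
Local Open Scope ring_scope.

Record network (R : realType) (K J : nat) := Network {
  group : 'I_J -> {set 'I_K};
  routing : 'M[R]_K;
  arrival : 'cV[R]_K;
  service : 'cV[R]_K;
  group_inj : injective group;
  group_partition : finset.partition [set group j | j : 'I_J]%SET [set: 'I_K]%SET;
  routing_ge0 : forall i k, 0 <= routing i k;
  routing_sum_le1 : forall i, \sum_k routing i k <= 1;
  arrival_ge0 : forall i, 0 <= arrival i 0;
  service_gt0 : forall i, 0 < service i 0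
}.

Definition open_network (R : realType) (K J : nat) (N : network R K J) : Prop :=
  cvgn (series (fun n : nat => (routing N)^T ^+ n)).

Lemma open_network_inverse (R : realType) (K J : nat) (N : network R K J) :
  open_network N ->
  1%:M - (routing N)^T \in unitmx /\
  series (fun n : nat => (routing N)^T ^+ n) @ \oo -->
    invmx (1%:M - (routing N)^T).
Proof.
rewrite /open_network; set A := (routing N)^T => h.
set L := limn (series (fun n : nat => A ^+ n)).
have hA : (fun n : nat => A ^+ n) @ \oo --> (0 : 'M[R]_K) by exact: cvg_series_cvg_0.
have E n : series (fun n : nat => A ^+ n) n *m (1%:M - A) = 1%:M - A ^+ n.
  rewrite /series/=; elim: n => [|n IH].
    by rewrite big_nil mul0mx expr0 subrr.
  rewrite big_nat_recr//= mulmxDl IH mulmxBr mulmx1 exprSr.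
  by rewrite addrA subrK.
have LE : L *m (1%:M - A) = 1%:M.
  apply/matrixP => i k.
  have c1 : (fun n => (series (fun n : nat => A ^+ n) n *m (1%:M - A)) i k) @ \oo --> (L *m (1%:M - A)) i k.
    under eq_fun do rewrite mxE. rewrite mxE.
    apply: cvg_big => [|j _]; first exact: add_continuous. apply: cvgM; last exact: cvg_cst.
    exact: (cvg_comp _ (fun M : 'M[R]_K => M i j) h (@coord_continuous _ _ _ i j L)).
  have c2 : (fun n => (series (fun n : nat => A ^+ n) n *m (1%:M - A)) i k) @ \oo --> (1%:M : 'M[R]_K) i k.
    under eq_fun do rewrite E mxE [X in _ + X]mxE.
    rewrite -[X in nbhs X]subr0; apply: cvgB; first exact: cvg_cst.
    have := cvg_comp _ (fun M : 'M[R]_K => M i k) hA (@coord_continuous _ _ _ i k 0).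
    by rewrite mxE.
  exact: cvg_unique c1 c2.
have U := (mulmx1_unit LE).2.
split=> //.
suff -> : invmx (1%:M - A) = L by [].
by rewrite -[LHS]mul1mx -[X in X *m _]LE -mulmxA mulmxV// mulmx1.
Qed.

(* ordS is the cyclic successor, so the product runs over the closed walk
   i_0, i_1, ..., i_l, i_0; l = 0 is a self-loop. *)
Definition acyclic (R : realType) (K J : nat) (N : network R K J) : Prop :=
  ~ exists (l : nat) (q : 'I_l.+1 -> 'I_K),
      0 < \prod_(m < l.+1) routing N (q m) (q (ordS m)).

Definition traffic (R : realType) (K J : nat) (N : network R K J) : 'cV[R]_K :=
  invmx (1%:M - (routing N)^T) *m arrival N.

Definition utilization_condition (R : realType) (K J : nat)
    (N : network R K J) : Prop :=
  exists2 eps : R, 0 < eps &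
    forall j : 'I_J,
      \sum_(i in group N j) traffic N i 0 / service N i 0 <= 1 - eps.

Definition max_queues (R : realType) (K : nat) (x : 'cV[R]_K) : {set 'I_K} :=
  [set i | [forall k, x k 0 <= x i 0]]%SET.

Definition dominating (R : realType) (K J : nat) (N : network R K J)
    (x : 'cV[R]_K) (j : 'I_J) : {set 'I_K} :=
  [set i in group N j |
    [forall s in max_queues x, (x i 0 < x s 0) ==> (routing N i s == 0)]]%SET.

Definition longest_dominating (R : realType) (K J : nat) (N : network R K J)
    (x : 'cV[R]_K) (j : 'I_J) : {set 'I_K} :=
  [set i in dominating N x j |
    [forall k in dominating N x j, x k 0 <= x i 0]]%SET.

(* The index set written as a calligraphic J. *)
Definition busy_groups (R : realType) (K J : nat) (N : network R K J)
    (x : 'cV[R]_K) : {set 'I_J} :=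
  [set j | [exists i in (group N j :&: max_queues x)%SET,
    [forall s in max_queues x, routing N i s == 0]]]%SET.

(* X and T are functions on [0, +oo[: their values at negative times are
   unconstrained junk. *)
Record fluid_solution (R : realType) (K J : nat) (N : network R K J)
    (X T : R -> 'cV[R]_K) : Prop := FluidSolution {
  fluid_level_ge0 : forall t k, 0 <= t -> 0 <= X t k 0;
  fluid_time_ge0 : forall t k, 0 <= t -> 0 <= T t k 0;
  fluid_time0 : forall k, T 0 k 0 = 0;
  fluid_time_nondecreasing :
    forall s t k, 0 <= s -> s <= t -> T s k 0 <= T t k 0;
  fluid_group_capacity : forall s t j, 0 <= s -> s <= t ->
    \sum_(i in group N j) (T t i 0 - T s i 0) <= t - s;
  fluid_balance : forall t k, 0 <= t ->
    X t k 0 = X 0 k 0 + arrival N k 0 * t - service N k 0 * T t k 0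
              + \sum_i routing N i k * service N i 0 * T t i 0
}.

Definition service_rate (R : realType) (K : nat) (T : R -> 'cV[R]_K)
    (i : 'I_K) (t : R) : R := derive1 (fun u : R => T u i 0) t.

Record LDQ_fluid_solution (R : realType) (K J : nat) (N : network R K J)
    (X T : R -> 'cV[R]_K) : Prop := LDQFluidSolution {
  LDQ_fluid :> fluid_solution N X T;
  LDQ_rates : forall t : R, 0 < t ->
    (forall i, derivable (fun u : R => T u i 0) t 1) -> X t != 0 ->
    forall j : 'I_J,
      [/\ j \in busy_groups N (X t) ->
            \sum_(i in longest_dominating N (X t) j) service_rate T i t = 1,
          j \notin busy_groups N (X t) ->
            \sum_(i in longest_dominating N (X t) j) service_rate T i t <= 1
        & \sum_(i in (group N j :\: longest_dominating N (X t) j)%SET)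
            service_rate T i t = 0]
}.

(* `|_| is the maximum norm on column vectors. *)
Definition LDQ_stable (R : realType) (K J : nat) (N : network R K J) : Prop :=
  exists2 delta : R, 0 < delta &
    forall X T : R -> 'cV[R]_K, LDQ_fluid_solution N X T -> `|X 0| <= 1 ->
      forall t : R, delta < t -> X t = 0.

(* Main.v *)
From HB Require Import structures.
Require Import Defs.
From mathcomp Require Import all_boot all_order all_algebra.
From mathcomp Require Import all_classical all_reals all_analysis.
From mathcomp Require Import measurable_realfun.
From mathcomp Require Import ring lra.

(* The Lyapunov function is the maximum level M(t) = max_k X_k(t), which is
   Lipschitz. Let t be a point where M and all the T_i are differentiable and
   X(t) <> 0, let S be the set of maximum queues and a = M'(t). Every queue of S
   has derivative a, and LDQ serves no queue outside S that feeds S, so the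
   departure rates d_i = mu_i T_i'(t) satisfy, for k in S,
     a = lambda_k - d_k + sum_(i in S) r_ik d_i.
   With w = (I - R^T)^-1 1 and b = max(0, -a), comparison with nu = lambda +
   R^T nu and w = 1 + R^T w gives d <= nu + b w on S. By acyclicity some queue
   of S feeds no queue of S; the group of that queue is busy and serves only
   queues of S, whence
     1 = sum d_i / mu_i <= 1 - eps + b sum w_i / mu_i.
   Thus M' is bounded above by a negative constant almost everywhere until M
   reaches 0, and M is the integral of its derivative. *)

Set Implicit Arguments.
Unset Strict Implicit.
Unset Printing Implicit Defensive.
Import Order.TTheory GRing.Theory Num.Theory.
Import numFieldNormedType.Exports.
Local Open Scope classical_set_scope.
Local Open Scope ring_scope.

(** * Lipschitz functions of a real variable *)

Lemma lebesgue_stieltjes_measure_itvoc (R : realType) (F : cumulative R R)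
    (a b : R) : a <= b ->
  lebesgue_stieltjes_measure F `]a, b] = (F b - F a)%:E.
Proof.
move=> ab; rewrite /lebesgue_stieltjes_measure /measure_extension/=.
by rewrite measurable_mu_extE/= ?wlength_itv_bnd//; exact: is_ocitv.
Qed.

(* The measures associated with [F] and [G] add up to the Lebesgue measure. *)
Lemma lebesgue_stieltjes_measure_dominates (R : realType)
    (F G : cumulative R R) : (forall x, F x + G x = x) ->
  lebesgue_stieltjes_measure F `<< @lebesgue_measure R.
Proof.
move=> FG; apply/null_content_dominatesP => A mA.
suff E : lebesgue_measure A = measure_add (lebesgue_stieltjes_measure F)
    (lebesgue_stieltjes_measure G) A.
  move=> A0; move: E; rewrite measure_addE [LHS]A0 => /esym/eqP.
  by rewrite padde_eq0 ?measure_ge0// => /andP[/eqP].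
apply: lebesgue_measure_unique mA => _ [[a b]/= _ <-]; rewrite [RHS]measure_addE.
have [ab|ba] := leP a b; last first.
  by rewrite set_itv_ge ?measure0 ?adde0// bnd_simp -leNgt ltW.
transitivity ((F b - F a)%:E + (G b - G a)%:E)%E; last first.
  by congr (_ + _)%E; exact/esym/lebesgue_stieltjes_measure_itvoc.
rewrite [LHS]lebesgue_stieltjes_measure_itvoc// -EFinD.
by congr EFin; rewrite /= -{1}(FG a) -{1}(FG b); ring.
Qed.

(** The intervals []-n, n]] exhaust the line and each has mass at most [M + M], so continuity from
    below bounds the total mass. Radon-Nikodym is applied to a finite measure. *)
Lemma lebesgue_stieltjes_measure_finite (R : realType) (F : cumulative R R)
    (M : R) : (forall x, `|F x| <= M) ->
  fin_num_fun (lebesgue_stieltjes_measure F).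
Proof.
move=> FM; apply: lty_fin_num_fun.
suff : (lebesgue_stieltjes_measure F [set: R] <= (M + M)%:E)%E.
  by move=> /le_lt_trans; apply; exact: ltry.
have cv : lebesgue_stieltjes_measure F `](- n%:R : R), n%:R]%classic
    @[n --> \oo] --> lebesgue_stieltjes_measure F [set: R].
  have <- : \bigcup_n `](- n%:R : R), n%:R]%classic = [set: R].
    apply/seteqP; split => // x _; exists (Num.bound `|x|) => //=.
    have := archi_boundP (normr_ge0 x); rewrite ltr_norml => /andP[? /ltW ?].
    by rewrite in_itv/=; apply/andP.
  apply: nondecreasing_cvg_mu => //; first exact: bigcup_measurable.
  by move=> m n mn; apply/subsetPset/subset_itv; rewrite leBSide//= ?lerN2 ler_nat.
rewrite -(cvg_lim _ cv)//; apply: lime_le; first exact: (cvgP _ cv).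
near=> n; rewrite lebesgue_stieltjes_measure_itvoc; last first.
  by rewrite -subr_ge0 opprK addr_ge0.
rewrite lee_fin (le_trans (ler_norm _))// (le_trans (ler_normB _ _))//.
exact: lerD.
Unshelve. all: by end_near. Qed.

(** Since [x = F x + (x - F x)] splits the identity into two nondecreasing continuous functions, the
    Stieltjes measure of [F] is dominated by Lebesgue measure. Its Radon-Nikodym density [g]
    integrates back to [F], and Lebesgue differentiation identifies [g] with the derivative almost
    everywhere. *)
Lemma lipschitz_nondecreasing_ae_derivable (R : realType) (F : R -> R) (M : R) :
  (forall x, `|F x| <= M) ->
  (forall x y, x <= y -> F x <= F y) ->
  (forall x y, x <= y -> F y - F x <= y - x) ->
  exists g : R -> R, [/\ forall x, 0 <= g x,
    measurable_fun setT g,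
    forall a b, a <= b ->
      (F b - F a)%:E = (\int[lebesgue_measure]_(x in `]a, b]) (g x)%:E)%E &
    {ae lebesgue_measure, forall x, derivable F x 1 /\ F^`()%classic x = g x}].
Proof.
move=> FM ndF lipF.
have cF : continuous F.
  move=> x; apply/cvgrPdist_le => /= e e0.
  near=> y.
  have xy : `|x - y| <= e by near: y; exact: cvgr_dist_le.
  apply: le_trans xy.
  have [xy|/ltW yx] := leP x y.
    rewrite distrC (distrC x) !ger0_norm ?subr_ge0 ?ndF//; exact: lipF.
  rewrite !ger0_norm ?subr_ge0 ?ndF//; exact: lipF.
have ndG : nondecreasing (fun x => x - F x).
  by move=> x y xy; have := lipF _ _ xy; lra.
have cG : continuous (fun x => x - F x).
  by move=> x; apply: cvgB; [exact: cvg_id|exact: cF].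
pose cumF := HB.pack_for (cumulative R R) F
  (isCumulative.Build R _ R F ndF (right_continuousW cF)).
pose cumG := HB.pack_for (cumulative R R) (fun x => x - F x)
  (isCumulative.Build R _ R _ ndG (right_continuousW cG)).
have dom : lebesgue_stieltjes_measure cumF `<< @lebesgue_measure R.
  apply: (@lebesgue_stieltjes_measure_dominates _ cumF cumG) => x /=.
  by rewrite addrC subrK.
have fin := @lebesgue_stieltjes_measure_finite _ cumF M FM.
pose nu := HB.pack_for {finite_measure set (measurableTypeR R) -> \bar R}
  (lebesgue_stieltjes_measure cumF)
  (@Measure_isFinite.Build _ _ _ (lebesgue_stieltjes_measure cumF) fin).
have [h [h0 hfin ih hE]] :=
  @radon_nikodym_sigma_finite _ _ _ (@lebesgue_measure R) nu dom.
pose g : R -> R := fun x => fine (h x).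
have hK x : (g x)%:E = h x by rewrite fineK.
have hKf : EFin \o g = h by apply/funext => x /=.
have FE a b : a <= b ->
    (F b - F a)%:E = (\int[lebesgue_measure]_(x in `]a, b]) (g x)%:E)%E.
  move=> ab; under eq_integral do rewrite hK.
  rewrite -hE//; exact/esym/(@lebesgue_stieltjes_measure_itvoc _ cumF).
exists g; split => //.
- by move=> x /=; rewrite fine_ge0.
- by apply/measurable_EFinP; rewrite hKf; case/integrableP : ih.
have ihS A : measurable A -> lebesgue_measure.-integrable A (EFin \o g).
  by rewrite hKf => mA; exact: (integrableS measurableT).
have loc : locally_integrable [set: R] g.
  apply: open_integrable_locally => //; first exact: openT.
  exact: ihS.
have := @FTC1Ny R g (fun y => ihS _ (measurable_itv _)) loc.
set G := (fun x => Rintegral _ _ _).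
(* By [FE], [F] and the integral [G] of [g] have the same increments, so they differ by a
   constant. *)
have FG x : F x = G x + (F 0 - G 0).
  have GE u v : u <= v -> G v - G u = F v - F u.
    move=> uv; rewrite /G Rintegral_itvB ?bnd_simp//; last exact: ihS.
    by rewrite /Rintegral -FE.
  have [x0|/ltW x0] := leP x 0; have := GE _ _ x0; lra.
apply: filterS; first exact: (ae_filter_ringOfSetsType lebesgue_measure).
move=> x [/derivableP dG GE].
have dF : is_derive x 1 F (g x).
  rewrite (_ : F = G + cst (F 0 - G 0)); last by apply/funext.
  by rewrite -GE derive1E -[X in is_derive _ _ _ X]addr0; exact: is_deriveD.
by split; [exact: ex_derive|rewrite derive1E; exact: derive_val].
Unshelve. all: by end_near. Qed.

(* [g] is the derivative of the nondecreasing 1-Lipschitz function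
   [(f x + k * x) / (2 * k)]. *)
Lemma lipschitz_itv_ae_derivative (R : realType) (f : R -> R) (a b k : R) :
  a < b -> 0 < k ->
  (forall x y, a <= x -> x <= y -> y <= b -> `|f y - f x| <= k * (y - x)) ->
  exists g : R -> R, [/\ forall x, 0 <= g x,
    measurable_fun setT g,
    ((f b - f a + k * (b - a)) / (2 * k))%:E =
      (\int[lebesgue_measure]_(x in `]a, b]) (g x)%:E)%E &
    {ae lebesgue_measure, forall x, a < x < b ->
      derivable f x 1 /\ f^`()%classic x = 2 * k * g x - k}].
Proof.
move=> ab k0 lipf.
(* Clamping to [[a, b]] extends [f] to the whole line with the same Lipschitz constant and changes
   nothing inside the interval. *)
pose cl x := Num.min (Num.max a x) b.
have cl_itv x : a <= cl x <= b.
  by rewrite le_min ge_min le_max lexx (ltW ab) lexx orbT.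
have cl_id x : a <= x -> x <= b -> cl x = x.
  by move=> ax xb; rewrite /cl (max_idPr ax) (min_idPl xb).
have cl_lip x y : x <= y -> 0 <= cl y - cl x <= y - x.
  move=> xy; rewrite /cl; case: (leP (Num.max a x) b); case: (leP (Num.max a y) b);
    by case: (leP a x); case: (leP a y) => *; apply/andP; split; lra.
pose h x := (f (cl x) + k * cl x) / (2 * k).
have k20 : 0 < 2 * k by rewrite mulr_gt0.
have h_lip x y : x <= y -> 0 <= h y - h x <= y - x.
  move=> xy; have /andP[c0 cxy] := cl_lip _ _ xy.
  have /andP[ax _] := cl_itv x; have /andP[_ yb] := cl_itv y.
  have xycl : cl x <= cl y by rewrite -subr_ge0.
  have := lipf _ _ ax xycl yb; rewrite ler_norml => /andP[lo hi].
  rewrite /h -mulrBl; apply/andP; split.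
    by apply: divr_ge0; [lra|exact: ltW].
  apply: le_trans cxy; rewrite ler_pdivrMr//; lra.
(* [h] is nondecreasing and factors through the clamp, so its values lie between [h a] and [h b];
   this gives the global bound. *)
have [||| g [g0 mg hg aeg]] := @lipschitz_nondecreasing_ae_derivable _ h (`|h a| + `|h b|).
- move=> x; have hx : h x = h (cl x).
    by have /andP[ax xb] := cl_itv x; rewrite /h (cl_id _ ax xb).
  have /andP[ax xb] := cl_itv x.
  have /andP[h1 _] := h_lip _ _ ax; have /andP[h2 _] := h_lip _ _ xb.
  rewrite hx; have := ler_norm (h b); have := ler_norm (- h a).
  have := normr_ge0 (h a); have := normr_ge0 (h b); rewrite normrN => *.
  rewrite ler_norml; apply/andP; split; lra.
- by move=> x y /h_lip/andP[+ _]; rewrite subr_ge0.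
- by move=> x y /h_lip/andP[].
exists g; split => //.
  rewrite -(hg _ _ (ltW ab)) /h !cl_id ?lexx ?(ltW ab)//.
  by congr EFin; rewrite -mulrBl; congr (_ / _); ring.
move: aeg; apply: filterS; first exact: (ae_filter_ringOfSetsType lebesgue_measure).
move=> x [/derivableP dh hgx] /andP[ax xb].
have fh : \near x, ((2 * k) *: h - k *: id) x = f x.
  near=> y.
  have ay : a <= y by apply: ltW; near: y; exact: lt_nbhsr.
  have yb : y <= b by apply: ltW; near: y; exact: lt_nbhsl.
  rewrite /h /= !fctE /GRing.scale /= cl_id//.
  by field; rewrite gt_eqF.
have df : is_derive x 1 f (2 * k * g x - k).
  apply: near_eq_is_derive fh _.
  rewrite (_ : _ - k = (2 * k) *: 'D_1 h x - k *: (1 : R)).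
    by apply: is_deriveB; apply: is_deriveZ.
  by rewrite -derive1E hgx /GRing.scale/= mulr1.
by split; [exact: ex_derive|rewrite derive1E; exact: derive_val].
Unshelve. all: by end_near. Qed.

Lemma lipschitz_itv_ae_derivable (R : realType) (f : R -> R) (a b k : R) :
  a < b ->
  (forall x y, a <= x -> x <= y -> y <= b -> `|f y - f x| <= k * (y - x)) ->
  {ae lebesgue_measure, forall x, a < x < b -> derivable f x 1}.
Proof.
move=> ab lipf.
(* [k] is not assumed positive, so the constant is enlarged to |k| + 1. *)
have [|x y ax xy yb|g [_ _ _]] := @lipschitz_itv_ae_derivative _ f a b (`|k| + 1) ab.
- by rewrite ltr_wpDl.
- apply: le_trans (lipf _ _ ax xy yb) _; rewrite ler_wpM2r ?subr_ge0//.
  by rewrite (le_trans (ler_norm k))// lerDl.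
apply: filterS; first exact: (ae_filter_ringOfSetsType lebesgue_measure).
by move=> x + axb => /(_ axb)[].
Qed.

(** With [f' = 2 l g - l] almost everywhere, [f' <= c] means [g <= (c + l) / (2 l)], and integrating
    [g] recovers the increment of [f]. Lipschitz continuity excludes a singular part. *)
Lemma lipschitz_ae_derivative_le (R : realType) (f : R -> R) (a b k c : R) :
  a < b ->
  (forall x y, a <= x -> x <= y -> y <= b -> `|f y - f x| <= k * (y - x)) ->
  {ae lebesgue_measure, forall x, a < x < b ->
    derivable f x 1 -> f^`()%classic x <= c} ->
  f b - f a <= c * (b - a).
Proof.
(* |k| keeps [l] a Lipschitz constant, |c| makes [c + l] nonnegative for the comparison of
   nonnegative integrands, and 1 makes [l] positive. *)
move=> ab lipf aec; pose l := `|k| + `|c| + 1.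
have l0 : 0 < l by rewrite ltr_wpDl// addr_ge0.
have [//|x y ax xy yb|g [g0 mg fE aeg]] := @lipschitz_itv_ae_derivative _ f a b l ab.
  apply: le_trans (lipf _ _ ax xy yb) _; rewrite ler_wpM2r ?subr_ge0//.
  by have := ler_norm k; have := normr_ge0 c; rewrite /l; lra.
have lc : 0 <= (c + l) / (2 * l).
  apply: divr_ge0; last by rewrite mulr_ge0// ltW.
  have := ler_norm (- c); rewrite normrN; have := normr_ge0 k; rewrite /l; lra.
have : (((f b - f a + l * (b - a)) / (2 * l))%:E <=
        ((c + l) / (2 * l) * (b - a))%:E)%E.
  have -> : ((c + l) / (2 * l) * (b - a))%:E =
      (\int[lebesgue_measure]_(x in `]a, b[) ((c + l) / (2 * l))%:E)%E.
    rewrite integral_cst//= lebesgue_measure_itv/= lte_fin ab -EFinB -EFinM//.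
  (* The derivative is controlled only on the open interval; dropping the endpoint [b] leaves the
     integral unchanged. *)
  rewrite fE -integral_itv_bndo_bndc; last first.
    by apply/measurable_EFinP; exact: measurable_funTS.
  apply: ae_ge0_le_integral => //.
  - by move=> x _; rewrite lee_fin.
  - by apply/measurable_EFinP; exact: measurable_funTS.
  apply: filterS2 aec aeg; first exact: (ae_filter_ringOfSetsType lebesgue_measure).
  move=> x cx gx /=; rewrite in_itv/= => axb.
  have [df dfE] := gx axb; have := cx axb df.
  rewrite dfE lee_fin ler_pdivlMr ?mulr_gt0//; lra.
rewrite lee_fin mulrAC ler_pM2r ?invr_gt0 ?mulr_gt0//; lra.
Qed.

(** * One-sided sign conditions and local minima *)

Lemma derive1_ge0_at_right (R : realType) (f : R -> R) (x : R) :
  derivable f x 1 -> (\forall y \near x^'+, f x <= f y) ->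
  0 <= f^`()%classic x.
Proof.
move=> df fx; rewrite derive1E ['D_1 f x]cvg_at_rightE//.
apply: limr_ge.
  rewrite -(cvg_at_rightE (fun h : R => h^-1 *: ((f \o shift x) _ - f x)))//.
  apply: cvg_trans df; apply: cvg_app.
  move=> A [e egt0 Ae]; exists e => // y ye ygt0; apply: Ae => //.
  exact: lt0r_neq0.
have [e /= e0 fe] := fx.
near=> h.
have h0 : 0 < h by near: h; exact: nbhs_right_gt.
apply: mulr_ge0; first by rewrite invr_ge0 ltW.
rewrite subr_ge0 /= [_%:A]mulr1; apply: fe; last by rewrite ltrDr.
rewrite /= opprD addrCA subrr addr0 normrN gtr0_norm//.
Unshelve. all: by end_near. Qed.

Lemma derive1_le0_at_left (R : realType) (f : R -> R) (x : R) :
  derivable f x 1 -> (\forall y \near x^'-, f x <= f y) ->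
  f^`()%classic x <= 0.
Proof.
move=> df fx; rewrite derive1E ['D_1 f x]cvg_at_leftE//.
apply: limr_le.
  rewrite -(cvg_at_leftE (fun h : R => h^-1 *: ((f \o shift x) _ - f x)))//.
  apply: cvg_trans df; apply: cvg_app.
  move=> A [e egt0 Ae]; exists e => // y ye ygt0; apply: Ae => //.
  exact: ltr0_neq0.
have [e /= e0 fe] := fx.
near=> h.
have h0 : h < 0 by near: h; exact: nbhs_left_lt.
apply: mulr_le0_ge0; first by rewrite invr_le0 ltW.
rewrite subr_ge0 /= [_%:A]mulr1; apply: fe; last by rewrite gtrDr.
rewrite /= opprD addrCA subrr addr0 normrN ltr0_norm// ltrNl.
by near: h; apply: nbhs_left_gt; rewrite oppr_lt0.
Unshelve. all: by end_near. Qed.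

Lemma derive1_local_min (R : realType) (f : R -> R) (x : R) :
  derivable f x 1 -> (\forall y \near x, f x <= f y) -> f^`()%classic x = 0.
Proof.
move=> df fx; apply/eqP; rewrite eq_le derive1_le0_at_left ?derive1_ge0_at_right//.
  exact: cvg_at_right_filter fx.
exact: cvg_at_left_filter fx.
Qed.

Lemma is_derive_linear_combination (R : realType) (K : nat) (x0 la m : R)
    (c : 'I_K -> R) (T : 'I_K -> R -> R) (dT : 'I_K -> R) (t : R) (k : 'I_K) :
  (forall i, is_derive t 1 (T i) (dT i)) ->
  is_derive t 1 (fun u => x0 + la * u - m * T k u + \sum_i c i * T i u)
    (la - m * dT k + \sum_i c i * dT i).
Proof.
move=> isT.
have -> : (fun u => x0 + la * u - m * T k u + \sum_i c i * T i u) =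
    cst x0 + la *: id - m *: T k + \sum_i c i *: T i.
  by apply/funext => u; rewrite !fctE fct_sumE.
have H := is_deriveD (is_deriveB (is_deriveD (is_derive_cst x0 t 1)
  (is_deriveZ la (is_derive_id t 1))) (is_deriveZ m (isT k)))
  (is_derive_sum (fun i => is_deriveZ (c i) (isT i))).
apply: is_derive_eq H _.
by rewrite add0r [la *: _]mulr1.
Qed.

(** * Acyclic and open networks *)

(** Pigeonhole: two of the first [#|T| + 1] iterates of [x] coincide. *)
Lemma iter_collision (T : finType) (h : T -> T) (x : T) :
  exists m n, iter n.+1 h (iter m h x) = iter m h x.
Proof.
have /injectivePn[i [j ij hij]] :
    ~~ injectiveb (fun i : 'I_#|T|.+1 => iter i h x).
  apply/negP => /injectiveP /leq_card; rewrite card_ord.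
  by rewrite ltnn.
wlog ltij : i j ij hij / (i < j)%N.
  move=> H; have [/H//|/H|/val_inj/eqP] := ltngtP i j; first exact.
    by rewrite eq_sym => /(_ ij); apply.
  by rewrite (negPf ij).
exists i, (j - i).-1; rewrite prednK ?subn_gt0// -iterD subnK ?(ltnW ltij)//.
Qed.

(** If every queue of [S] fed a queue of [S], a choice of successors would map [S] to itself; its
    orbits are eventually periodic, and a period is a closed walk of positive routing
    probability. *)
Lemma acyclic_has_sink (R : realType) (K J : nat) (N : network R K J)
    (S : {set 'I_K}) (s0 : 'I_K) : acyclic N -> s0 \in S ->
  exists2 i, i \in S & forall s, s \in S -> routing N i s = 0.
Proof.
move=> acN s0S; apply: contrapT => nosink.
have next i : exists s, i \in S -> s \in S /\ 0 < routing N i s.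
  have [iS|iS] := boolP (i \in S); last by exists i.
  apply: contrapT => nos; apply: nosink; exists i => // s sS.
  apply/eqP; rewrite eq_le routing_ge0 andbT leNgt; apply/negP => rs.
  by apply: nos; exists s.
have [h hP] := choice next.
have [m [n hmn]] := iter_collision h s0.
have itS k : iter k h s0 \in S by elim: k => //= k /hP[].
apply: acN; exists n, (fun i => iter i h (iter m h s0)).
apply: prodr_gt0 => i _.
suff -> : iter (ordS i) h (iter m h s0) = h (iter i h (iter m h s0)).
  by rewrite -iterD; exact: (hP _ (itS _)).2.
(* The cyclic successor of the last index is 0, where the collision [hmn] closes the walk. *)
rewrite -iterS /=; have := ltn_ord i; rewrite ltnS leq_eqVlt => /orP[/eqP->|lin].
  by rewrite modnn.
by rewrite modn_small.
Qed.

(* Entry [i] is the expected number of visits to queue [i] when one job starts in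
   each queue. *)
Definition visits (R : realType) (K J : nat) (N : network R K J) : 'cV[R]_K :=
  invmx (1%:M - (routing N)^T) *m const_mx 1.

(** Reciprocal of the guaranteed rate of decrease of the maximum level. Summing over all queues, not
    over one group, makes it independent of the group that yields the bound. *)
Definition drain_time (R : realType) (K J : nat) (N : network R K J)
    (eps : R) : R :=
  (\sum_i visits N i 0 / service N i 0) / eps.

Section open.
Context (R : realType) (K J : nat) (N : network R K J) (openN : open_network N).

Local Notation V := (invmx (1%:M - (routing N)^T)).

(** The partial sums of the Neumann series have nonnegative entries, and this passes to the
    limit. *)
Lemma open_network_inverse_ge0 i k : 0 <= V i k.
Proof.
have [_ sV] := open_network_inverse openN.
have c := cvg_comp _ (fun M : 'M[R]_K => M i k) sV (@coord_continuous _ _ _ i k _).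
apply: (cvgr_to_ge c); apply: nearW => n /=.
rewrite summxE; apply: sumr_ge0 => m _.
elim: m i k {c} => [|m IH] i k; first by rewrite expr0 mxE ler0n.
rewrite exprS mxE; apply: sumr_ge0 => l _; rewrite mxE mulr_ge0//.
exact: routing_ge0.
Qed.

Lemma open_network_solution_ge0 (v : 'cV[R]_K) i :
  (forall k, 0 <= v k 0) -> 0 <= (V *m v) i 0.
Proof.
by move=> v0; rewrite mxE sumr_ge0// => k _; rewrite mulr_ge0// open_network_inverse_ge0.
Qed.

Lemma open_network_solutionE (v : 'cV[R]_K) k :
  (V *m v) k 0 = v k 0 + \sum_i routing N i k * (V *m v) i 0.
Proof.
have [U _] := open_network_inverse openN.
have : (1%:M - (routing N)^T) *m (V *m v) = v by rewrite mulmxA mulmxV// mul1mx.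
move=> /matrixP/(_ k 0); rewrite mulmxBl mul1mx mxE [X in _ + X]mxE => /eqP.
rewrite subr_eq => /eqP ->; congr (_ + _); rewrite mxE.
by apply: eq_bigr => i _; rewrite mxE.
Qed.

(** With [z = R^T y - y >= 0], inverting [(I - R^T) y = - z] gives [y = - V z], and [V] has
    nonnegative entries. *)
Lemma open_network_subsolution_le0 (y : 'I_K -> R) :
  (forall k, y k <= \sum_i routing N i k * y i) -> forall k, y k <= 0.
Proof.
move=> yle k; have [U _] := open_network_inverse openN.
pose z : 'cV[R]_K := \col_i (\sum_j routing N j i * y j - y i).
have z0 i : 0 <= z i 0 by rewrite mxE subr_ge0.
have E : (1%:M - (routing N)^T) *m (\col_i y i) = - z.
  apply/matrixP => i j; rewrite mulmxBl mul1mx !mxE opprB; congr (_ - _).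
  by apply: eq_bigr => l _; rewrite !mxE.
have : \col_i y i = V *m - z by rewrite -E mulmxA mulVmx// mul1mx.
move=> /matrixP/(_ k 0); rewrite mulmxN !mxE => ->.
rewrite oppr_le0; have := open_network_solution_ge0 k z0; by rewrite mxE.
Qed.


Lemma visits_ge0 i : 0 <= visits N i 0.
Proof. by apply: open_network_solution_ge0 => k; rewrite mxE. Qed.

Lemma drain_time_ge0 (eps : R) : 0 < eps -> 0 <= drain_time N eps.
Proof.
move=> eps0; rewrite divr_ge0 ?(ltW eps0)// sumr_ge0// => i _.
by rewrite divr_ge0 ?visits_ge0// ltW// service_gt0.
Qed.

(** The product form avoids dividing by [drain_time]; as that is nonnegative, the bound forces it to
    be positive and [a] to be negative. *)
Lemma max_level_drift (S : {set 'I_K}) (d : 'I_K -> R) (a eps : R) (j : 'I_J) :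
  0 < eps ->
  \sum_(i in group N j) traffic N i 0 / service N i 0 <= 1 - eps ->
  (forall k, k \in S ->
    a = arrival N k 0 - d k + \sum_(i in S) routing N i k * d i) ->
  \sum_(i in group N j :&: S) d i / service N i 0 = 1 ->
  a * drain_time N eps <= - 1.
Proof.
move=> eps0 util aE d1.
pose b := Num.max 0 (- a).
have b0 : 0 <= b by rewrite le_max lexx.
have nu0 i : 0 <= traffic N i 0.
  by apply: open_network_solution_ge0 => k; exact: arrival_ge0.
(* [u] solves the traffic equations with every arrival rate raised by [b]. On [S], [d] solves them
   restricted to [S] and raised by [- a <= b], so [u] should dominate [d]. *)
pose u i := traffic N i 0 + b * visits N i 0.
have u0 i : 0 <= u i by rewrite addr_ge0// mulr_ge0// visits_ge0.
have uE k : u k = arrival N k 0 + b + \sum_i routing N i k * u i.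
  rewrite /u /traffic /visits !(open_network_solutionE _ k) mxE mulrDr mulr1.
  rewrite addrACA; congr (_ + _); rewrite mulr_sumr -big_split/=.
  by apply: eq_bigr => i _; rewrite mulrDr; congr (_ + _); rewrite mulrCA.
(* Vanishing off [S], [y] is a subsolution on the whole network. *)
pose y i := if i \in S then Num.max 0 (d i - u i) else 0.
have y0 i : 0 <= y i by rewrite /y; case: ifP; rewrite ?le_max ?lexx.
have y_le0 := open_network_subsolution_le0 (y := y).
have du i : i \in S -> d i <= u i.
  move=> iS; have : y i <= 0.
    apply: y_le0 => k; have s0 : 0 <= \sum_i routing N i k * y i.
      by apply: sumr_ge0 => l _; rewrite mulr_ge0// routing_ge0.
    rewrite {1}/y; case: ifPn => // kS; rewrite ge_max s0/= uE.
    have := aE _ kS => /eqP; rewrite -addrA addrC -subr_eq => /eqP.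
    have ab : - a <= b by rewrite le_max lexx orbT.
    have : \sum_(i in S) routing N i k * u i <= \sum_i routing N i k * u i.
      rewrite [leRHS](bigID (mem S))/= lerDl; apply: sumr_ge0 => l _.
      by rewrite mulr_ge0// routing_ge0.
    have : \sum_(i in S) routing N i k * d i - \sum_(i in S) routing N i k * u i
        <= \sum_i routing N i k * y i.
      rewrite [leRHS](bigID (mem S))/= -sumrB -[leLHS]addr0 lerD//; last first.
        by apply: sumr_ge0 => l _; rewrite mulr_ge0// routing_ge0.
      apply: ler_sum => l lS; rewrite -mulrBr ler_wpM2l ?routing_ge0//.
      by rewrite /y lS le_max lexx orbT.
    lra.
  by rewrite /y iS ge_max subr_le0 => /andP[].
have bB : eps <= b * \sum_i (visits N i 0 / service N i 0).
  have : 1 <= 1 - eps + b * \sum_i (visits N i 0 / service N i 0); last by lra.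
  rewrite -{1}d1; apply: (@le_trans _ _ (\sum_(i in group N j) u i / service N i 0)).
    rewrite [leRHS](bigID (mem S))/= -[leLHS]addr0 lerD//; last first.
      by apply: sumr_ge0 => l _; rewrite divr_ge0// ltW// service_gt0.
    under eq_bigl do rewrite inE.
    apply: ler_sum => i /andP[_ iS].
    by rewrite ler_pM2r ?invr_gt0 ?service_gt0// du.
  rewrite /u; under eq_bigr do rewrite mulrDl.
  rewrite big_split/= lerD// mulr_sumr [leRHS](bigID (mem (group N j)))/=.
  under eq_bigr do rewrite -mulrA.
  rewrite lerDl; apply: sumr_ge0 => l _.
  by rewrite mulr_ge0// divr_ge0 ?visits_ge0// ltW// service_gt0.
(* If [a] were positive, [b] would be 0, against [bB]. *)
have a0 : - a = b.
  rewrite /b; case: leP => // a0; move: bB.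
  have -> : b = 0 by apply: max_l; exact: ltW.
  by rewrite mul0r leNgt eps0.
rewrite /drain_time mulrA -[a]opprK a0 mulNr mulNr lerN2 ler_pdivlMr//.
by rewrite mul1r.
Qed.

End open.

(** * Fluid solutions *)

Section fluid.
Context (R : realType) (K J : nat) (N : network R K J) (X T : R -> 'cV[R]_K).

Lemma group_exists i : exists j, i \in group N j.
Proof.
have /and3P[/eqP cov _ _] := group_partition N.
have : i \in finset.cover [set group N j | j : 'I_J]%SET by rewrite cov inE.
by case/bigcupP => A /imsetP[j _ ->]; exists j.
Qed.

(** The default 0 does not affect the maximum of nonnegative levels and also covers a network
    without queues. *)
Definition max_level (u : R) : R := \big[Num.max/0]_k X u k 0.

Lemma max_level_ge0 u : 0 <= max_level u.
Proof. exact: bigmax_ge_id. Qed.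

Lemma max_level_ge u k : X u k 0 <= max_level u.
Proof. exact: (le_bigmax _ (fun i => X u i 0)). Qed.

Lemma max_level_eq0 u : (forall k, 0 <= X u k 0) -> max_level u = 0 -> X u = 0.
Proof.
move=> Xge0 Mu; apply/matrixP => k l; rewrite ord1 mxE; apply/eqP.
by rewrite eq_le Xge0 andbT -Mu max_level_ge.
Qed.

Lemma max_level_max_queue u k : 0 <= X u k 0 -> k \in max_queues (X u) ->
  X u k 0 = max_level u.
Proof.
rewrite inE => Xk0 /forallP kmax; apply/eqP.
by rewrite eq_le max_level_ge; apply: bigmax_le => // i _; exact: kmax.
Qed.

Lemma max_queues_neq0 u : X u != 0 -> exists i, i \in max_queues (X u).
Proof.
move=> Xu; have [k0 _] : exists k : 'I_K, True.
  apply: contrapT => noK; move/eqP: Xu; apply; apply/matrixP => k.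
  by exfalso; apply: noK; exists k.
have [i _ imax] := arg_maxP (fun k => X u k 0) (isT : xpredT k0).
by exists i; rewrite inE; apply/forallP => k; exact: imax.
Qed.

Context (flu : fluid_solution N X T).

(** The increment is one of the nonnegative summands bounded together by the capacity of the queue's
    group. *)
Lemma fluid_time_lipschitz s t i : 0 <= s -> s <= t ->
  `|T t i 0 - T s i 0| <= t - s.
Proof.
move=> s0 st; have [j ij] := group_exists i.
rewrite ger0_norm ?subr_ge0; last exact: (fluid_time_nondecreasing flu).
apply: le_trans (fluid_group_capacity flu j s0 st).
rewrite (bigD1 i)//= lerDl sumr_ge0// => k _.
by rewrite subr_ge0; exact: (fluid_time_nondecreasing flu).
Qed.

(** The balance equation makes each level Lipschitz with constant [l k]; the sum of these is a
    common constant, which the maximum inherits. *)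
Lemma max_level_lipschitz : exists L : R, forall s t, 0 <= s -> s <= t ->
  `|max_level t - max_level s| <= L * (t - s).
Proof.
pose l k := arrival N k 0 + service N k 0 + \sum_i routing N i k * service N i 0.
have l0 k : 0 <= l k.
  rewrite !addr_ge0 ?arrival_ge0 ?(ltW (service_gt0 _ _))//.
  by apply: sumr_ge0 => i _; rewrite mulr_ge0 ?routing_ge0// ltW// service_gt0.
exists (\sum_k l k) => s t s0 st.
have t0 := le_trans s0 st.
have ts0 : 0 <= t - s by rewrite subr_ge0.
have Xlip k : `|X t k 0 - X s k 0| <= (\sum_k l k) * (t - s).
  apply: (@le_trans _ _ (l k * (t - s))); last first.
    rewrite ler_wpM2r// (bigD1 k)//= lerDl; exact: sumr_ge0.
  rewrite (fluid_balance flu k s0) (fluid_balance flu k t0).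
  have -> : forall x0 la m Tt Ts St Ss : R,
      x0 + la * t - m * Tt + St - (x0 + la * s - m * Ts + Ss) =
      la * (t - s) - m * (Tt - Ts) + (St - Ss) by move=> *; ring.
  rewrite -sumrB /l !mulrDl.
  apply: le_trans (ler_normD _ _) _; apply: lerD.
    apply: le_trans (ler_normB _ _) _.
    rewrite !normrM (ger0_norm ts0) (ger0_norm (arrival_ge0 _ _)) lerD2l.
    by rewrite (gtr0_norm (service_gt0 _ _)) ler_pM2l ?service_gt0// fluid_time_lipschitz.
  apply: le_trans (ler_norm_sum _ _ _) _; rewrite mulr_suml; apply: ler_sum => i _.
  rewrite -mulrBr normrM ger0_norm ?mulr_ge0 ?routing_ge0 ?(ltW (service_gt0 _ _))//.
  by rewrite ler_wpM2l ?mulr_ge0 ?routing_ge0 ?(ltW (service_gt0 _ _)) ?fluid_time_lipschitz.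
have L0 : 0 <= (\sum_k l k) * (t - s) by rewrite mulr_ge0// sumr_ge0.
rewrite ler_norml lerBlDr lerNl opprB lerBlDr.
apply/andP; split; apply: bigmax_le; rewrite ?addr_ge0 ?max_level_ge0// => k _.
  have := Xlip k; rewrite ler_norml => /andP[+ _]; have := max_level_ge t k; lra.
have := Xlip k; rewrite ler_norml => /andP[_]; have := max_level_ge s k; lra.
Qed.

Lemma service_rate_ge0 i t : 0 < t -> derivable (fun u => T u i 0) t 1 ->
  0 <= service_rate T i t.
Proof.
move=> t0 dT; apply: derive1_ge0_at_right => //.
near=> y; apply: (fluid_time_nondecreasing flu); first exact: ltW.
by apply: ltW; near: y; exact: nbhs_right_gt.
Unshelve. all: by end_near. Qed.

Lemma fluid_level_is_derive k t : 0 < t ->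
  (forall i, derivable (fun u => T u i 0) t 1) ->
  is_derive t 1 (fun u => X u k 0) (arrival N k 0
    - service N k 0 * service_rate T k t
    + \sum_i routing N i k * service N i 0 * service_rate T i t).
Proof.
move=> t0 dT.
have isT i : is_derive t 1 (fun u => T u i 0) (service_rate T i t).
  by rewrite /service_rate derive1E; apply: derivableP.
have := is_derive_linear_combination (X 0 k 0) (arrival N k 0) (service N k 0)
  (fun i => routing N i k * service N i 0) k isT.
apply: near_eq_is_derive.
near=> u; apply/esym/(fluid_balance flu).
by apply: ltW; near: u; exact: lt_nbhsr.
Unshelve. all: by end_near. Qed.

End fluid.

(** * Drift of the maximum level under LDQ, and stability *)

Lemma max_queues_dominating (R : realType) (K J : nat) (N : network R K J)
    (x : 'cV[R]_K) (j : 'I_J) i :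
  i \in group N j -> i \in max_queues x -> i \in longest_dominating N x j.
Proof.
rewrite !inE => -> /forallP imax /=; apply/andP; split.
  by apply/forallP => s; apply/implyP => _; rewrite ltNge imax.
by apply/forallP => k; rewrite imax implybT.
Qed.

Lemma longest_dominating_max_queues (R : realType) (K J : nat)
    (N : network R K J) (x : 'cV[R]_K) (j : 'I_J) i0 :
  i0 \in group N j -> i0 \in max_queues x ->
  longest_dominating N x j = (group N j :&: max_queues x)%SET.
Proof.
move=> i0j i0m; apply/setP => i; rewrite [RHS]inE; apply/idP/andP; last first.
  by case; exact: max_queues_dominating.
have := max_queues_dominating i0j i0m; rewrite inE => /andP[i0d _].
rewrite inE => /andP[id /forallP/(_ i0)]; rewrite i0d/= => i0i.
move: id; rewrite inE => /andP[ij _]; split => //.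
move: i0m; rewrite !inE => /forallP i0max; apply/forallP => k.
exact: le_trans (i0max k) i0i.
Qed.

Lemma LDQ_max_level_drift (R : realType) (K J : nat) (N : network R K J)
    (X T : R -> 'cV[R]_K) (eps t : R) :
  open_network N -> acyclic N -> 0 < eps ->
  (forall j, \sum_(i in group N j) traffic N i 0 / service N i 0 <= 1 - eps) ->
  LDQ_fluid_solution N X T -> 0 < t ->
  (forall i, derivable (fun u => T u i 0) t 1) -> X t != 0 ->
  derivable (max_level X) t 1 ->
  (max_level X)^`()%classic t * drain_time N eps <= - 1.
Proof.
move=> oN acN eps0 util ldq t0 dT Xt0 dM.
have flu := LDQ_fluid ldq.
have X0 k : 0 <= X t k 0 by apply: (fluid_level_ge0 flu); exact: ltW.
have [s0 s0S] := max_queues_neq0 Xt0.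
have [i0 i0S sink] := acyclic_has_sink acN s0S.
have [j i0j] := group_exists N i0.
have rates := LDQ_rates ldq t0 dT Xt0.
(* A shorter queue feeding a maximum queue is not dominating, so its rate is a term of a vanishing
   sum of nonnegative rates. *)
have rate0 i : i \notin max_queues (X t) ->
    (exists2 k, k \in max_queues (X t) & routing N i k != 0) ->
    service_rate T i t = 0.
  move=> iS [k kS rik]; have [l il] := group_exists N i.
  have [_ _ /eqP] := rates l; rewrite psumr_eq0; last first.
    by move=> m _; exact: (service_rate_ge0 flu).
  move=> /allP/(_ i (mem_index_enum _)).
  have ik : X t i 0 < X t k 0.
    rewrite ltNge; apply: contra iS => ki; rewrite inE; apply/forallP => m.
    by move: kS; rewrite inE => /forallP/(_ m)/le_trans; exact.
  rewrite inE il andbT => /implyP H; apply/eqP; apply: H.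
  rewrite !inE il/=; apply/negP => /andP[/forallP/(_ k)].
  by rewrite kS ik (negPf rik).
apply: (max_level_drift oN (S := max_queues (X t))
  (d := fun i => service N i 0 * service_rate T i t) (j := j)) => //.
  move=> k kS.
  have dX := fluid_level_is_derive flu k t0 dT.
  have dMX := is_deriveB (derivableP dM) dX.
  (* The gap between the maximum level and [X_k] is nonnegative and vanishes at [t], so its
     derivative there is 0: [M] and [X_k] have the same derivative. *)
  have gap0 u :
      (max_level X - (fun v => X v k 0)) t <= (max_level X - (fun v => X v k 0)) u.
    rewrite !fctE (max_level_max_queue (X0 k) kS) subrr.
    by rewrite subr_ge0; exact: max_level_ge.
  have := derive1_local_min (@ex_derive _ _ _ _ _ _ _ dMX) (filterE _ gap0).
  rewrite derive1E (@derive_val _ _ _ _ _ _ _ dMX) -derive1E => /(_ (nbhs_filter t))/eqP.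
  rewrite subr_eq0 => /eqP ->.
  congr (_ + _); rewrite [LHS](bigID (mem (max_queues (X t))))/=.
  rewrite [X in _ + X]big1 ?addr0; last first.
    move=> i iS; have [->|rik] := eqVneq (routing N i k) 0; first by rewrite !mul0r.
    by rewrite (rate0 i iS) ?mulr0//; exists k.
  by apply: eq_bigr => i _; rewrite mulrA.
(* The group [j] of the sink [i0] is busy, and only maximum queues of it are served, so their rates
   sum to 1. *)
rewrite -(longest_dominating_max_queues i0j i0S).
have [busy _ _] := rates j; rewrite -busy.
  by apply: eq_bigr => i _; rewrite mulrAC divff ?mul1r// gt_eqF// service_gt0.
rewrite inE; apply/existsP; exists i0; rewrite inE i0j i0S/=.
by apply/forallP => s; apply/implyP => /sink ->.
Qed.

(** At [X t = 0] the maximum level is minimal, so its derivative is 0. Otherwise [a * D <= - 1] and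
    [a <= 0] give [a * (D + 1) <= - 1], where [D + 1] is visibly positive. *)
Lemma LDQ_max_level_derive1 (R : realType) (K J : nat) (N : network R K J)
    (X T : R -> 'cV[R]_K) (eps t : R) :
  open_network N -> acyclic N -> 0 < eps ->
  (forall j, \sum_(i in group N j) traffic N i 0 / service N i 0 <= 1 - eps) ->
  LDQ_fluid_solution N X T -> 0 < t ->
  (forall i, derivable (fun u => T u i 0) t 1) ->
  derivable (max_level X) t 1 ->
  (max_level X)^`()%classic t <= 0 /\
  (X t != 0 -> (max_level X)^`()%classic t <= - (drain_time N eps + 1)^-1).
Proof.
move=> oN acN eps0 util ldq t0 dT dM.
have D0 := drain_time_ge0 oN eps0.
have [Xt0|Xt0] := eqVneq (X t) 0.
  split=> //; rewrite derive1_local_min//; apply: filterE => u.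
  rewrite (_ : max_level X t = 0) ?max_level_ge0//.
  apply/eqP; rewrite eq_le max_level_ge0 andbT; apply: bigmax_le => // k _.
  by rewrite Xt0 mxE.
have := LDQ_max_level_drift oN acN eps0 util ldq t0 dT Xt0 dM.
set a := _^`()%classic t => aD.
have a0 : a <= 0.
  rewrite leNgt; apply/negP => a0.
  by have := mulr_ge0 (ltW a0) D0; lra.
split => // _.
rewrite lerNr -[_^-1]mul1r ler_pdivrMr; lra.
Qed.

Theorem theorem4p1 (R : realType) (K J : nat) (N : network R K J) :
  open_network N -> acyclic N -> utilization_condition N -> LDQ_stable N.
Proof.
move=> oN acN [eps eps0 util].
have D0 := drain_time_ge0 oN eps0.
have D1 : 0 < drain_time N eps + 1 by rewrite ltr_wpDl.
(* The maximum level starts at most at 1 and falls at rate at least [(D + 1)^-1] while positive. *)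
exists (drain_time N eps + 1) => // X T ldq X01 t Dt.
have flu := LDQ_fluid ldq.
have t0 : 0 < t := lt_trans D1 Dt.
have [L Mlip] := max_level_lipschitz flu.
have Mlip_on a b x y : 0 <= a -> a <= x -> x <= y -> y <= b ->
    `|max_level X y - max_level X x| <= L * (y - x).
  by move=> a0 ax xy _; apply: Mlip => //; exact: le_trans ax.
(* A finite union of null sets is null, so all [T_i] are differentiable off a single null set. *)
have aeT (b : R) : 0 < b -> {ae lebesgue_measure, forall u : R,
    forall i : 'I_K, 0 < u < b -> derivable (fun v => T v i 0) u 1}.
  move=> b0; apply: filter_forall => i.
  apply: (@lipschitz_itv_ae_derivable _ _ _ _ 1) => // x y x0 xy _.
  by rewrite mul1r; exact: (fluid_time_lipschitz flu).
(* Monotonicity shows that a network nonempty at [t] was nonempty at every earlier time, so the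
   strict drift applies on all of []0, t[]. *)
have Mdecr s : 0 <= s -> s < t -> max_level X t <= max_level X s.
  move=> s0 st.
  have := @lipschitz_ae_derivative_le _ (max_level X) s t L 0 st.
  rewrite mul0r subr_le0; apply => [x y|]; first exact: Mlip_on.
  move: (aeT _ t0); apply: filterS; first exact: (ae_filter_ringOfSetsType lebesgue_measure).
  move=> u dT /andP[su ut] dM; have u0 := le_lt_trans s0 su.
  by apply: (LDQ_max_level_derive1 oN acN eps0 util ldq u0 _ dM).1 => i; apply: dT; rewrite u0.
apply/eqP/negPn/negP => Xt0.
have Mt0 : 0 < max_level X t.
  rewrite lt_neqAle max_level_ge0 andbT eq_sym; apply: contra Xt0 => /eqP M0.
  by apply/eqP/max_level_eq0 => // k; apply: (fluid_level_ge0 flu); exact: ltW.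
have Xneq0 s : 0 <= s -> s < t -> X s != 0.
  move=> s0 st; apply: contraTneq (Mdecr _ s0 st) => Xs.
  rewrite -ltNge; apply: le_lt_trans Mt0; apply: bigmax_le => // k _.
  by rewrite Xs mxE.
(* Integrating the strict drift gives [M(t) <= 1 - t / (D + 1) < 0], contradicting [Mt0]. *)
have : max_level X t - max_level X 0 <= - (drain_time N eps + 1)^-1 * (t - 0).
  apply: (@lipschitz_ae_derivative_le _ (max_level X) 0 t L) => // [x y|].
    exact: Mlip_on.
  move: (aeT _ t0); apply: filterS; first exact: (ae_filter_ringOfSetsType lebesgue_measure).
  move=> u dT /andP[u0 ut] dM.
  apply: (LDQ_max_level_derive1 oN acN eps0 util ldq u0 _ dM).2 => [i|].
    by apply: dT; rewrite u0.
  by apply: Xneq0 => //; exact: ltW.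
rewrite subr0 mulNr.
have M01 : max_level X 0 <= 1.
  apply: bigmax_le => // k _; apply: le_trans X01.
  apply: le_trans (ler_norm _) _; rewrite [leRHS]mx_normrE.
  exact: (le_bigmax _ (fun ij => `|X 0 ij.1 ij.2|) (k, 0)).
have : 1 < (drain_time N eps + 1)^-1 * t by rewrite mulrC ltr_pdivlMr// mul1r.
lra.
Qed.
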